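(* Let $f\in\mathbb{R}^{D}$ and let $(X_n)_{n\in\mathbb{N}}$ be a Markov chain with transition matrix $P$ and initial distribution $\nu$. Let $P$ be reversible with respect to $\pi$ and let $\beta<1$. Then for all $n\in\mathbb{N}$ and $n_0\in\mathbb{N}\cup\{0\}$ $$e_\nu(S_{n,n_0},f)^2 \leq \frac{2}{n(1-\beta_1)} \|f\|_{2}^2 + \frac{2 \beta^{n_0} \sqrt{\left\|\frac{1}{\pi}\right\|_{\infty}}\, \left\|\frac{\nu}{\pi}-1\right\|_{2} }{n^2(1-\beta)^2} \|f\|_{2}^2 .$$ Moreover, with $a_k=\langle f,u_k\rangle$, for every fixed $n_0$ one has $$\lim_{n\to \infty} n\cdot e_\nu(S_{n,n_0},f)^2 =\lim_{n\to \infty} n\cdot e_\pi(S_{n},f)^2 = \sum_{k=1}^{|D|-1} a_k^2\, \frac{1+\beta_k}{1-\beta_k}.$$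
   Context: $\mathbb{N}=\{1,2,\dots\}$. $D$ is a finite set (with $|D|\ge 2$). A Markov chain $(X_n)_{n\in\mathbb{N}}$ on $D$ with transition matrix $P=(p(x,y))_{x,y\in D}$ and initial distribution $\nu$ satisfies $\Pr(X_1=x)=\nu(x)$ and $\Pr(X_{n+1}=y\mid X_1,\dots,X_n)=p(X_n,y)$. Throughout, $P$ is irreducible, aperiodic and reversible with respect to a probability measure $\pi$ on $D$, i.e. $\pi(x)p(x,y)=\pi(y)p(y,x)$ for all $x,y\in D$; then $\pi$ is the unique stationary distribution and $\pi(x)>0$ for all $x$. On $\mathbb{R}^D$ let $\langle f,g\rangle=\sum_{x\in D} f(x)g(x)\pi(x)$, $\|f\|_2=\langle f,f\rangle^{1/2}$ and $\|f\|_\infty=\max_{x\in D}|f(x)|$; $\frac1\pi$ and $\frac{\nu}{\pi}$ denote the functions $x\mapsto 1/\pi(x)$ and $x\mapsto \nu(x)/\pi(x)$. $P$ acts by $Pf(x)=\sum_y f(y)p(x,y)$ and is self-adjoint for $\langle\cdot,\cdot\rangle$. Its eigenvalues are $1=\beta_0>\beta_1\ge\beta_2\ge\dots\ge\beta_{|D|-1}$ with an orthonormal basis of eigenvectors $u_0\equiv 1,u_1,\dots,u_{|D|-1}$, $Pu_i=\beta_iu_i$. Put $\beta=\max\{\beta_1,|\beta_{|D|-1}|\}$. $S(f)=\sum_{x\in D}f(x)\pi(x)$, $S_{n,n_0}(f)=\frac1n\sum_{j=1}^n f(X_{j+n_0})$, $S_n=S_{n,0}$. The error is $e_\nu(S_{n,n_0},f)=\big(\mathbf{E}_{\nu,P}|S_{n,n_0}(f)-S(f)|^2\big)^{1/2}$,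 the expectation being taken for the Markov chain with transition matrix $P$ and initial distribution $\nu$; $e_\pi(S_n,f)$ is the error when the initial distribution is $\pi$ (and $n_0=0$). *)

(* Defs.v *)
From HB Require Import structures.
From mathcomp Require Import all_boot all_order all_algebra.
From mathcomp Require Import all_classical all_reals all_analysis.
Set Implicit Arguments.
Unset Strict Implicit.
Unset Printing Implicit Defensive.
Import Order.TTheory GRing.Theory Num.Theory.
Import numFieldNormedType.Exports.
Local Open Scope classical_set_scope.
Local Open Scope ring_scope.

Definition is_distribution (R : realType) (D : finType) (mu : D -> R) : Prop :=
  (forall x, 0 <= mu x) /\ \sum_(x : D) mu x = 1.

Definition is_transition_matrix (R : realType) (D : finType)
    (p : D -> D -> R) : Prop :=
  forall x, is_distribution (p x).

Fixpoint nstep (R : realType) (D : finType) (p : D -> D -> R) (n : nat)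
    (x y : D) : R :=
  if n is m.+1 then \sum_(z : D) p x z * nstep p m z y else (x == y)%:R.

Definition irreducible (R : realType) (D : finType) (p : D -> D -> R) : Prop :=
  forall x y, exists n, 0 < nstep p n x y.

(* The gcd of {n >= 1 | p^n(x, x) > 0} is 1, expressed by saying that 1 is its
   only common divisor. *)
Definition aperiodic (R : realType) (D : finType) (p : D -> D -> R) : Prop :=
  forall (x : D) (k : nat),
    (forall n, (0 < n)%N -> 0 < nstep p n x x -> (k %| n)%N) -> k = 1%N.

Definition reversible (R : realType) (D : finType) (p : D -> D -> R)
    (pi : D -> R) : Prop :=
  forall x y, pi x * p x y = pi y * p y x.

Definition inner (R : realType) (D : finType) (pi f g : D -> R) : R :=
  \sum_(x : D) f x * g x * pi x.

Definition norm2 (R : realType) (D : finType) (pi f : D -> R) : R :=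
  Num.sqrt (inner pi f f).

Definition norm_inf (R : realType) (D : finType) (f : D -> R) : R :=
  \big[Num.max/0]_(x : D) `|f x|.

Definition Pop (R : realType) (D : finType) (p : D -> D -> R) (f : D -> R)
    (x : D) : R :=
  \sum_(y : D) f y * p x y.

(* Only the indices i < #|D| of b and u are meaningful. An orthonormal family
   of #|D| functions on D is a basis, so b 0, ..., b #|D|.-1 are all the
   eigenvalues of Pop p, with multiplicity and in nonincreasing order. *)
Record spectral_data (R : realType) (D : finType) (p : D -> D -> R)
    (pi : D -> R) (b : nat -> R) (u : nat -> D -> R) : Prop := SpectralData {
  spectral_val0 : b 0%N = 1;
  spectral_vec0 : forall x, u 0%N x = 1;
  spectral_sorted :
    forall i j, (i <= j)%N -> (j < #|D|)%N -> b j <= b i;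
  spectral_eigen :
    forall i, (i < #|D|)%N -> forall x, Pop p (u i) x = b i * u i x;
  spectral_orthonormal :
    forall i j, (i < #|D|)%N -> (j < #|D|)%N ->
      inner pi (u i) (u j) = (i == j)%:R
}.

Definition beta_max (R : realType) (D : finType) (b : nat -> R) : R :=
  Num.max (b 1%N) `|b #|D|.-1|.

Definition cond_prob (R : realType) (d : measure_display)
    (T : measurableType d) (Pr : probability T R) (B A : set T) : R :=
  fine (Pr (B `&` A)) / fine (Pr A).

(* The event X_1 = x_1, ..., X_n = x_n. *)
Definition path_event (T : Type) (D : finType) (X : nat -> T -> D)
    (n : nat) (x : nat -> D) : set T :=
  [set w | forall i, (1 <= i <= n)%N -> X i w = x i].

(* Time starts at 1, so X 0 is unconstrained. D carries the discrete
   sigma-algebra. *)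
Record markov_chain (R : realType) (D : finType) (d : measure_display)
    (T : measurableType d) (Pr : probability T R)
    (p : D -> D -> R) (nu : D -> R) (X : nat -> T -> D) : Prop := MarkovChain {
  markov_measurable :
    forall n (A : set D), (0 < n)%N -> measurable (X n @^-1` A);
  markov_init :
    forall x, Pr [set w | X 1%N w = x] = (nu x)%:E;
  markov_step :
    forall n (x : nat -> D) (y : D), (0 < n)%N ->
      Pr (path_event X n x) != 0%E ->
      cond_prob Pr [set w | X n.+1 w = y] (path_event X n x) = p (x n) y
}.

Definition Smean (R : realType) (D : finType) (pi f : D -> R) : R :=
  \sum_(x : D) f x * pi x.

Definition Savg (R : realType) (D : finType) (T : Type) (X : nat -> T -> D)
    (f : D -> R) (n n0 : nat) (w : T) : R :=
  n%:R^-1 * \sum_(1 <= j < n.+1) f (X (j + n0)%N w).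

(* The integrand takes finitely many values along a Markov chain, so fine
   loses nothing. *)
Definition err (R : realType) (D : finType) (d : measure_display)
    (T : measurableType d) (Pr : probability T R) (pi : D -> R)
    (X : nat -> T -> D) (f : D -> R) (n n0 : nat) : R :=
  Num.sqrt (fine (expectation Pr
    (fun w => `|Savg X f n n0 w - Smean pi f| ^+ 2))).

(* Main.v *)
(* Write g = f - S(f). Expanding the square, n^2 e_nu^2 is the double sum over
   i, j < n of E[g(X_i) g(X_j)]. Under the stationary distribution this
   covariance is sum_(k >= 1) a_k^2 b_k^|i-j|; under nu it differs from that
   value by <P^(n0 + min(i,j)) (nu/pi - 1), g P^|i-j| g>, which the contraction
   of P on the complement of the constants bounds by a multiple of
   beta^(n0 + max(i,j)). The double sum of b^|i-j| is n(1+b)/(1-b) up to a bounded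
   error, and that of beta^max(i,j) is at most 2/(1-beta)^2. *)
Require Import Defs.
From HB Require Import structures.
From mathcomp Require Import all_boot all_order all_algebra.
From mathcomp Require Import all_classical all_reals all_analysis.
From mathcomp Require Import ring lra.
Set Implicit Arguments.
Unset Strict Implicit.
Unset Printing Implicit Defensive.
Import Order.TTheory GRing.Theory Num.Theory.
Import numFieldNormedType.Exports.
Local Open Scope classical_set_scope.
Local Open Scope ring_scope.

(** * Expectations of functions of a finite-valued variable *)

Section FiniteExpectation.
Variables (R : realType) (d : measure_display) (T : measurableType d).
Variable Pr : probability T R.

(** The function is a finite combination of indicators of the fibres of [V], so linearity of the
    integral applies. *)
Lemma expectation_finite_valued (K : finType) (V : T -> K) (phi : K -> R) :
  (forall k, measurable (V @^-1` [set k])) ->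
  expectation Pr (phi \o V) =
    (\sum_k phi k * fine (Pr (V @^-1` [set k])))%:E.
Proof.
move=> mV.
have int k : Pr.-integrable setT
    (fun w => ((phi k)%:E * (\1_(V @^-1` [set k]) w)%:E)%E).
  by apply: integrableZl => //; apply: integrable_indic.
rewrite unlock; under eq_integral => w _.
  have -> : ((phi \o V) w)%:E =
      (\sum_k (phi k)%:E * (\1_(V @^-1` [set k]) w)%:E)%E.
    rewrite (bigD1 (V w))//= big1 ?adde0.
      by rewrite indicE mem_set// mule1.
    by move=> k kV; rewrite indicE memNset ?mule0// => /= Vk; rewrite Vk eqxx in kV.
  over.
rewrite integral_sum//= -sumEFin; apply: eq_bigr => k _.
rewrite integralZl//; last exact: integrable_indic.
rewrite integral_indic// setIT EFinM fineK//.
exact: fin_num_measure.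
Qed.

Definition Er (phi : T -> R) : R := fine (expectation Pr phi).

Lemma Er_finite (K : finType) (V : T -> K) (phi : K -> R) :
  (forall k, measurable (V @^-1` [set k])) ->
  Er (fun w => phi (V w)) = \sum_k phi k * fine (Pr (V @^-1` [set k])).
Proof. by move=> mV; rewrite /Er (@expectation_finite_valued _ V phi). Qed.

End FiniteExpectation.

(** * The Markov property and two-time expectations *)

Section Chain.
Variables (R : realType) (D : finType) (d : measure_display).
Variables (T : measurableType d) (Pr : probability T R).
Variables (p : D -> D -> R) (nu : D -> R) (X : nat -> T -> D).
Hypothesis hX : markov_chain Pr p nu X.

Local Notation E := (Er Pr).

(* [prefix N i] is X_(i+1): the ordinals start at 0 but time starts at 1. *)
Definition prefix (N : nat) (w : T) : {ffun 'I_N.+1 -> D} :=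
  [ffun i : 'I_N.+1 => X i.+1 w].

Lemma prefixE N i w : (i <= N)%N -> X i.+1 w = prefix N w (inord i).
Proof. by move=> iN; rewrite ffunE inordK. Qed.

(** The predecessor undoes the shift between ordinals and times, so that [markov_step] can be
    applied to the values of [prefix]. *)
Lemma prefix_event N (t : {ffun 'I_N.+1 -> D}) :
  prefix N @^-1` [set t] = path_event X N.+1 (fun k => t (inord k.-1)).
Proof.
apply/seteqP; split => w /=.
  by move=> <- [|i]// /= iN; rewrite ffunE inordK.
move=> H; apply/ffunP => i; rewrite ffunE H ?ltn_ord//=.
by rewrite inord_val.
Qed.

Lemma measurable_state i x : measurable (X i.+1 @^-1` [set x]).
Proof. exact: (markov_measurable hX). Qed.

Lemma measurable_prefix N (t : {ffun 'I_N.+1 -> D}) :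
  measurable (prefix N @^-1` [set t]).
Proof.
have -> : prefix N @^-1` [set t] =
    \bigcap_(i in [set: 'I_N.+1]) (X i.+1 @^-1` [set t i]).
  apply/seteqP; split => w /=.
    by move=> <- i _ /=; rewrite ffunE.
  by move=> H; apply/ffunP => i; rewrite ffunE; exact: H.
apply: fin_bigcap_measurable => [|i _]; first exact: finite_finset.
exact: measurable_state.
Qed.

Lemma Er_init (h : D -> R) : E (fun w => h (X 1 w)) = \sum_x nu x * h x.
Proof.
rewrite (Er_finite Pr h (measurable_state 0)).
apply: eq_bigr => x _; rewrite mulrC; congr (_ * _).
by have /= := markov_init hX x => ->.
Qed.

(** This is the tower property for conditioning on the whole past, checked atom by atom on the
    values of [prefix N]. *)
Lemma Er_markov N (phi : {ffun 'I_N.+1 -> D} -> R) (h : D -> R) :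
  E (fun w => phi (prefix N w) * h (X N.+2 w)) =
  E (fun w => phi (prefix N w) * Pop p h (X N.+1 w)).
Proof.
pose V w := (prefix N w, X N.+2 w).
have mV k : measurable (V @^-1` [set k]).
  have -> : V @^-1` [set k] =
      prefix N @^-1` [set k.1] `&` X N.+2 @^-1` [set k.2].
    apply/seteqP; split => w /=; first by move=> <-.
    by rewrite /V => -[-> ->]; case: k.
  by apply: measurableI; [exact: measurable_prefix|exact: measurable_state].
rewrite (@Er_finite _ _ _ _ _ V (fun k => phi k.1 * h k.2))//.
under [in RHS]eq_fun do rewrite (@prefixE N N)//.
rewrite (@Er_finite _ _ _ _ _ (prefix N)
  (fun t => phi t * Pop p h (t (inord N)))); last exact: measurable_prefix.
transitivity (\sum_t \sum_y phi t * h y * fine (Pr (V @^-1` [set (t, y)]))).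
  by rewrite pair_bigA; apply: eq_bigr => -[].
apply: eq_bigr => t _; rewrite /Pop mulr_sumr mulr_suml.
apply: eq_bigr => y _; rewrite -!mulrA; congr (_ * (_ * _)).
have -> : V @^-1` [set (t, y)] =
    [set w | X N.+2 w = y] `&` prefix N @^-1` [set t].
  by apply/seteqP; split => w /=; rewrite /V; [case=> -> ->|case=> -> ->].
(* [markov_step] is silent on null pasts; there the joint event lies in a null event and both sides
   vanish. *)
have [P0|P0] := eqVneq (Pr (prefix N @^-1` [set t])) 0%E.
  rewrite P0 mulr0 (@subset_measure0 _ _ _ Pr _ (prefix N @^-1` [set t]))//.
    by apply: measurableI; [exact: measurable_state|exact: measurable_prefix].
  exact: measurable_prefix.
have := @markov_step _ _ _ _ _ _ _ _ hX N.+1 (fun k => t (inord k.-1)) y isT.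
rewrite -prefix_event => /(_ P0); rewrite /cond_prob /= => <-.
rewrite mulfVK//; apply: contra P0 => /eqP P0.
by rewrite -(fineK (fin_num_measure Pr _ (measurable_prefix t))) P0.
Qed.

(** Induction on the lag: averaging out the last transition replaces [h] by [Pop p h], while the
    factor at time [i.+1] belongs to the past. *)
Lemma Er_two_times i m (g h : D -> R) :
  E (fun w => g (X i.+1 w) * h (X (i + m).+1 w)) =
  E (fun w => g (X i.+1 w) * iter m (Pop p) h (X i.+1 w)).
Proof.
elim: m h => [|m IH] h; first by rewrite addn0.
rewrite addnS; under eq_fun do rewrite (@prefixE (i + m) i) ?leq_addr//.
rewrite (Er_markov (fun t => g (t (inord i)))) iterSr -IH.
by congr Er; apply/funext => w; rewrite -prefixE ?leq_addr.
Qed.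

Lemma Er_one_time i (h : D -> R) :
  E (fun w => h (X i.+1 w)) = \sum_x nu x * iter i (Pop p) h x.
Proof.
have := @Er_two_times 0 i (fun=> 1) h; rewrite add0n.
by under eq_fun do rewrite mul1r; move=> ->; under eq_fun do rewrite mul1r;
  exact: Er_init.
Qed.

End Chain.

(** * Geometric sums and double sums of powers *)

Section PowerSums.
Variable R : realType.

(** The distance to the limit is at most [C / n]; this turns error bounds uniform in [n] into
    limits. *)
Lemma cvg_of_rate (x : nat -> R) (l C : R) :
  (forall n, (0 < n)%N -> `|n%:R * (x n - l)| <= C) -> x @ \oo --> l.
Proof.
move=> H; apply/cvgrPdist_le => e e0; near=> n.
have n0 : (0 < n)%N by near: n; exact: nbhs_infty_gt.
have nR : 0 < n%:R :> R by rewrite ltr0n.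
have Ce : C / e <= n%:R by near: n; exact: nbhs_infty_ger.
rewrite distrC -(ler_pM2l nR); have := H n n0.
rewrite normrM (gtr0_norm nR) => /le_trans; apply.
by rewrite -ler_pdivrMr.
Unshelve. all: by end_near. Qed.

(** Enlarging the square by one adds a corner and two borders that are equal by symmetry. *)
Lemma symmetric_double_sum_recr (F : nat -> nat -> R) n :
  (forall i j, F i j = F j i) ->
  \sum_(i < n.+1) \sum_(j < n.+1) F i j =
  \sum_(i < n) \sum_(j < n) F i j + F n n + 2 * \sum_(i < n) F i n.
Proof.
move=> Fsym; rewrite big_ord_recr /= big_ord_recr /=.
under eq_bigr do rewrite big_ord_recr /=.
rewrite big_split /=; under [\sum_(i < n) F n i]eq_bigr do rewrite Fsym.
ring.
Qed.

Lemma geometric_sumE n (b : R) : (1 - b) * \sum_(i < n) b ^+ i = 1 - b ^+ n.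
Proof. by rewrite -(opprB b) mulNr -subrX1 opprB. Qed.

(* In the stationary chain u_k(X_i) and u_k(X_j) have covariance b_k^|i-j|, so
   [covsum n (b k)] is the variance of the sum of n consecutive u_k(X_i). *)
Definition covsum (n : nat) (b : R) : R :=
  \sum_(i < n) \sum_(j < n) b ^+ (maxn i j - minn i j).

(** With the factor [1 - b] on the left the induction is polynomial: the new border is [b] times a
    geometric sum, which telescopes. *)
Lemma covsumE n b :
  (1 - b) * covsum n b = n%:R * (1 + b) - 2 * b * \sum_(i < n) b ^+ i.
Proof.
elim: n => [|n IH]; first by rewrite /covsum !big_ord0; ring.
rewrite /covsum
  (@symmetric_double_sum_recr (fun i j => b ^+ (maxn i j - minn i j))); last first.
  by move=> i j; rewrite maxnC minnC.
(* Along the new border the exponents [n - i] run through 1, ..., n, as reversing the index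
   shows. *)
have -> : \sum_(i < n) b ^+ (maxn i n - minn i n) =
    b * \sum_(i < n) b ^+ i.
  rewrite mulr_sumr (reindex_inj rev_ord_inj) /=; apply: eq_bigr => i _.
  have le : (n - i.+1 <= n)%N by rewrite leq_subr.
  by rewrite (maxn_idPr le) (minn_idPl le) subKn// exprS.
rewrite maxnn minnn subnn expr0 2!mulrDr -/(covsum n b) IH big_ord_recr /=.
rewrite -[n.+1]addn1 natrD.
have -> : (1 - b) * (2 * (b * \sum_(i < n) b ^+ i)) = 2 * b * (1 - b ^+ n).
  by rewrite -geometric_sumE; ring.
ring.
Qed.

(** This bound has constant one and serves the explicit estimate; the next one is uniform in [n] and
    serves the limit. *)
Lemma geometric_sum_norm_le n (b : R) : `|b| <= 1 ->
  `|\sum_(i < n) b ^+ i| <= n%:R.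
Proof.
move=> b1; apply: le_trans (ler_norm_sum _ _ _) _.
rewrite -[n in leRHS]card_ord -sumr_const.
by apply: ler_sum => i _; rewrite normrX exprn_ile1.
Qed.

Lemma geometric_sum_norm_bounded n (b : R) : `|b| < 1 ->
  `|\sum_(i < n) b ^+ i| <= 2 / `|1 - b|.
Proof.
move=> b1.
have b1' : 1 - b != 0.
  by rewrite subr_eq0; apply: contraTneq b1 => <-; rewrite normr1 ltxx.
rewrite ler_pdivlMr ?normr_gt0// mulrC -normrM.
rewrite geometric_sumE; apply: le_trans (ler_normB _ _) _; rewrite normr1 normrX.
by rewrite -[2]/(1 + 1) lerD2l exprn_ile1// ltW.
Qed.

Lemma covsum_le n (b : R) : `|b| < 1 -> covsum n b <= 2 * n%:R / (1 - b).
Proof.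
move=> /[dup] b1 /ltr_normlP[bN b0].
rewrite ler_pdivlMr ?subr_gt0// mulrC covsumE.
have /ler_normlP[s0 s1] := geometric_sum_norm_le n (ltW b1).
move: s0 s1; set s := \sum_(i < n) _ => s0 s1.
have n0 : 0 <= n%:R :> R by [].
(* For [b >= 0] both terms are nonnegative; for [b < 0] the bound [s <= n] leaves
   [n (1 + b) >= 0]. *)
suff : 0 <= n%:R * (1 - b) + 2 * b * s by lra.
have [bge0|blt0] := leP 0 b.
  have s_ge0 : 0 <= s by apply: sumr_ge0 => i _; exact: exprn_ge0.
  by rewrite addr_ge0// !mulr_ge0// subr_ge0 ltW.
have : 0 <= - b * (n%:R - s) by rewrite mulr_ge0// ?subr_ge0// oppr_ge0 ltW.
have : 0 <= n%:R * (1 + b) by rewrite mulr_ge0//; lra.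
nra.
Qed.

(** By [covsumE] the difference is exactly a fixed multiple of a geometric sum, which is bounded in
    [n]. *)
Lemma covsum_approx n (b : R) : `|b| < 1 ->
  `|covsum n b - n%:R * ((1 + b) / (1 - b))| <=
  `|2 * b / (1 - b)| * (2 / `|1 - b|).
Proof.
move=> b1; have b1' : 1 - b != 0.
  by rewrite subr_eq0; apply: contraTneq b1 => <-; rewrite normr1 ltxx.
have -> : covsum n b - n%:R * ((1 + b) / (1 - b)) =
    - (2 * b / (1 - b) * \sum_(i < n) b ^+ i).
  by apply: (mulfI b1'); rewrite mulrBr covsumE; field.
by rewrite normrN normrM ler_wpM2l// geometric_sum_norm_bounded.
Qed.

(** The maximum equals [m] at [2 m + 1] pairs, at most [2 (m + 1)], and the series of [(m + 1) b^m]
    sums to [1 / (1 - b)^2]. *)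
Lemma sum_expr_maxn_le n (b : R) : 0 <= b -> b < 1 ->
  \sum_(i < n) \sum_(j < n) b ^+ maxn i j <= 2 / (1 - b) ^+ 2.
Proof.
move=> b0 b1.
have E m : \sum_(i < m) \sum_(j < m) b ^+ maxn i j <=
    2 * \sum_(j < m) j.+1%:R * b ^+ j.
  elim: m => [|m IH]; first by rewrite !big_ord0 mulr0.
  rewrite (@symmetric_double_sum_recr (fun i j => b ^+ maxn i j)); last first.
    by move=> i j; rewrite maxnC.
  rewrite big_ord_recr /= maxnn.
  have -> : \sum_(i < m) b ^+ maxn i m = m%:R * b ^+ m.
    rewrite -[m in m%:R]card_ord -sumr_const mulr_suml.
    by apply: eq_bigr => i _; rewrite mul1r (maxn_idPr (ltnW (ltn_ord i))).
  have : 0 <= b ^+ m by exact: exprn_ge0.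
  rewrite -[m.+1]addn1 natrD; lra.
(* Closed form of the differentiated geometric sum, with the denominator cleared. *)
have C m : (1 - b) ^+ 2 * \sum_(j < m) j.+1%:R * b ^+ j =
    1 - m.+1%:R * b ^+ m + m%:R * b ^+ m.+1.
  elim: m => [|m IH]; first by rewrite big_ord0; ring.
  rewrite big_ord_recr /= mulrDr IH -[m.+2]addn1 -[m.+1]addn1 !natrD !exprD.
  ring.
rewrite ler_pdivlMr ?exprn_gt0 ?subr_gt0//.
apply: le_trans (_ : 2 * ((1 - b) ^+ 2 * \sum_(j < n) j.+1%:R * b ^+ j) <= _).
  by rewrite [leRHS]mulrCA [leLHS]mulrC ler_wpM2l// exprn_ge0// subr_ge0 ltW.
rewrite C -[n.+1]addn1 natrD exprD expr1.
(* The closed form equals [1 - b^n - n b^n (1 - b)], hence is at most 1. *)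
have : 0 <= b ^+ n by exact: exprn_ge0.
have : 0 <= n%:R * b ^+ n * (1 - b).
  by rewrite !mulr_ge0 ?exprn_ge0// subr_ge0 ltW.
lra.
Qed.

End PowerSums.

(** * Inequalities for the weighted inner product *)

Section Inner.
Variables (R : realType) (D : finType) (pi : D -> R).
Hypothesis pi_ge0 : forall x, 0 <= pi x.

Lemma inner_ge0 (f : D -> R) : 0 <= inner pi f f.
Proof. by apply: sumr_ge0 => x _; rewrite mulr_ge0// -expr2 sqr_ge0. Qed.

Lemma norm2_sqr (f : D -> R) : norm2 pi f ^+ 2 = inner pi f f.
Proof. by rewrite sqr_sqrtr// inner_ge0. Qed.

(** Lagrange's identity: the discriminant is half of a weighted double sum of squares. *)
Lemma inner_cauchy_schwarz (f g : D -> R) :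
  `|inner pi f g| <= norm2 pi f * norm2 pi g.
Proof.
rewrite /norm2 -sqrtrM ?inner_ge0// -sqrtr_sqr ler_wsqrtr//.
have : 0 <= \sum_x \sum_y pi x * pi y * (f x * g y - f y * g x) ^+ 2.
  by apply: sumr_ge0 => x _; apply: sumr_ge0 => y _; rewrite mulr_ge0 ?sqr_ge0// mulr_ge0.
have -> : \sum_x \sum_y pi x * pi y * (f x * g y - f y * g x) ^+ 2 =
    2 * (inner pi f f * inner pi g g - inner pi f g ^+ 2).
  transitivity (inner pi f f * inner pi g g + inner pi g g * inner pi f f
    - 2 * (inner pi f g * inner pi f g)); last by ring.
  rewrite /inner !big_distrlr /= mulr_sumr -big_split -sumrB /=.
  apply: eq_bigr => x _; rewrite mulr_sumr -big_split -sumrB /=.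
  by apply: eq_bigr => y _; ring.
lra.
Qed.

Lemma norm_inf_ge (f : D -> R) x : `|f x| <= norm_inf f.
Proof. exact: le_bigmax. Qed.

(** Each [f x ^+ 2 * pi x] is one term of the squared norm of [f], so passing to the supremum of
    [|f|] costs the square root of the supremum of [1 / pi]. This is the origin of that factor in
    the theorem. *)
Lemma norm2_mul_le (f g : D -> R) : (forall x, 0 < pi x) ->
  norm2 pi (fun x => f x * g x) <=
  Num.sqrt (norm_inf (fun x => 1 / pi x)) * norm2 pi f * norm2 pi g.
Proof.
move=> pi_gt0; have f0 := inner_ge0 f; have g0 := inner_ge0 g.
have N0 : 0 <= norm_inf (fun x => 1 / pi x).
  by rewrite /norm_inf; elim/big_ind: _ => // a c a0 c0; rewrite le_max a0.
rewrite /norm2 -!sqrtrM ?mulr_ge0// ler_wsqrtr//.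
rewrite {1 3}/inner mulr_sumr; apply: ler_sum => x _.
rewrite mulrACA -[leLHS]mulrA ler_wpM2r//; first by rewrite mulr_ge0// -expr2 sqr_ge0.
rewrite -expr2.
have fx : f x ^+ 2 * pi x <= inner pi f f.
  rewrite /inner (bigD1 x)//= -expr2 lerDl sumr_ge0// => y _.
  by rewrite -expr2 mulr_ge0 ?sqr_ge0.
have -> : f x ^+ 2 = 1 / pi x * (f x ^+ 2 * pi x).
  by field; rewrite gt_eqF.
apply: ler_pM => //; first by rewrite divr_ge0.
  by rewrite mulr_ge0 ?sqr_ge0.
by apply: le_trans (norm_inf_ge _ x); exact: ler_norm.
Qed.

End Inner.

(** Measures how far the start [nu] is from stationarity; the second term of the error bound is a
    multiple of it. *)
Definition bias_const (R : realType) (D : finType) (pi nu f : D -> R) : R :=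
  Num.sqrt (norm_inf (fun x => 1 / pi x))
    * norm2 pi (fun x => nu x / pi x - 1) * norm2 pi f ^+ 2.

(** * Spectral decomposition of the transition operator *)

Section Spectral.
Variables (R : realType) (D : finType) (p : D -> D -> R) (pi : D -> R).
Variables (b : nat -> R) (u : nat -> D -> R).
Hypothesis hD : (2 <= #|D|)%N.
Hypothesis hpi : is_distribution pi.
Hypothesis hrev : reversible p pi.
Hypothesis hspec : spectral_data p pi b u.

Local Notation beta := (beta_max D b).
Local Notation ip := (inner pi).

Let pi_ge0 x : 0 <= pi x. Proof. by case: hpi. Qed.

(* A square matrix with orthonormal rows has orthonormal columns. *)
Lemma spectral_complete x y :
  \sum_(k < #|D|) u k x * u k y * pi x = (x == y)%:R.
Proof.
pose M := \matrix_(k < #|D|, j < #|D|) u k (enum_val j).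
pose N := \matrix_(j < #|D|, k < #|D|) (u k (enum_val j) * pi (enum_val j)).
have MN : M *m N = 1%:M.
  apply/matrixP => i j; rewrite !mxE -(spectral_orthonormal hspec) ?ltn_ord//.
  rewrite /inner (reindex (@enum_val D D)) /=; last first.
    by apply: onW_bij; exact: enum_val_bij.
  by apply: eq_bigr => k _; rewrite !mxE mulrA.
have /matrixP/(_ (enum_rank x) (enum_rank y)) := mulmx1C MN.
rewrite !mxE (inj_eq enum_rank_inj) => <-.
by apply: eq_bigr => k _; rewrite !mxE !enum_rankK mulrAC.
Qed.

(** On the diagonal, completeness says that [pi x] times a sum of squares equals 1. *)
Lemma spectral_pi_gt0 x : 0 < pi x.
Proof.
rewrite lt_neqAle pi_ge0 andbT; apply/eqP => pi0.
have := spectral_complete x x; rewrite eqxx -pi0 big1.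
  by move/eqP; rewrite eq_sym oner_eq0.
by move=> k _; rewrite mulr0.
Qed.

(** The completeness relation is substituted for the Kronecker delta in a double sum over [x] and
    [y]. *)
Lemma parseval (f g : D -> R) :
  ip f g = \sum_(0 <= k < #|D|) ip f (u k) * ip g (u k).
Proof.
rewrite big_mkord.
transitivity (\sum_x \sum_y f x * g y * pi y * (x == y)%:R).
  apply: eq_bigr => x _; rewrite (bigD1 x)//= eqxx mulr1 big1 ?addr0//.
  by move=> y yx; rewrite eq_sym (negbTE yx) mulr0.
under eq_bigr => x _ do under eq_bigr => y _ do
  rewrite -spectral_complete mulr_sumr.
under [RHS]eq_bigr do rewrite /inner big_distrlr /=.
rewrite [RHS]exchange_big /=; apply: eq_bigr => x _.
rewrite exchange_big /= [RHS]exchange_big /= exchange_big /=.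
by apply: eq_bigr => y _; apply: eq_bigr => k _; ring.
Qed.

Lemma Pop_self_adjoint (f g : D -> R) : ip (Pop p f) g = ip f (Pop p g).
Proof.
rewrite /inner /Pop.
under eq_bigr do rewrite !mulr_suml.
under [RHS]eq_bigr do rewrite mulr_sumr mulr_suml.
rewrite exchange_big /=; apply: eq_bigr => y _; apply: eq_bigr => x _.
have := hrev x y => /(congr1 (fun r => f y * g x * r)) E.
transitivity (f y * g x * (pi x * p x y)); first by ring.
by rewrite E; ring.
Qed.

Lemma iter_Pop_self_adjoint m (f g : D -> R) :
  ip (iter m (Pop p) f) g = ip f (iter m (Pop p) g).
Proof. by elim: m g => // m IH g; rewrite iterS Pop_self_adjoint IH -iterSr. Qed.

Lemma inner_iter_Pop m (f : D -> R) k : (k < #|D|)%N ->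
  ip (iter m (Pop p) f) (u k) = b k ^+ m * ip f (u k).
Proof.
move=> kD; elim: m => [|m IH]; first by rewrite expr0 mul1r.
rewrite iterS Pop_self_adjoint exprS -mulrA -IH /inner mulr_sumr.
by apply: eq_bigr => x _; rewrite (spectral_eigen hspec)//; ring.
Qed.

Lemma inner_u0 (f : D -> R) : ip f (u 0) = Smean pi f.
Proof. by apply: eq_bigr => x _; rewrite (spectral_vec0 hspec) mulr1. Qed.

Lemma beta_max_ge0 : 0 <= beta.
Proof. by rewrite le_max normr_ge0 orbT. Qed.

(** By monotonicity [b k] lies between the last eigenvalue and [b 1]. *)
Lemma eigenvalue_norm_le k : (0 < k < #|D|)%N -> `|b k| <= beta.
Proof.
move=> /andP[k0 kD]; rewrite ler_norml; apply/andP; split.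
  rewrite lerNl; apply: le_trans (_ : - b #|D|.-1 <= _).
    rewrite lerN2 (spectral_sorted hspec)//; first by rewrite -ltnS prednK ?(leq_trans _ kD).
    by rewrite prednK// (leq_trans _ kD).
  by rewrite le_max -[X in _ || (_ <= X)]normrN ler_norm orbT.
by rewrite le_max (spectral_sorted hspec).
Qed.

(** In the eigenbasis each step multiplies coefficient [k] by [b k]; the coefficient at [k = 0],
    whose eigenvalue is 1, is absent by hypothesis. *)
Lemma iter_Pop_contraction m (f : D -> R) : ip f (u 0) = 0 ->
  norm2 pi (iter m (Pop p) f) <= beta ^+ m * norm2 pi f.
Proof.
move=> f0; have bm0 : 0 <= beta ^+ m by rewrite exprn_ge0// beta_max_ge0.
rewrite -ler_sqr ?nnegrE ?sqrtr_ge0 ?mulr_ge0 ?sqrtr_ge0//.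
rewrite exprMn !norm2_sqr// !parseval mulr_sumr.
apply: ler_sum_nat => k kD; rewrite !inner_iter_Pop; try by case/andP: kD.
have [->|k0] := posnP k; first by rewrite f0 !mulr0.
rewrite -!expr2 exprMn ler_wpM2r ?sqr_ge0//.
rewrite -[leLHS]real_normK ?num_real// ler_sqr ?nnegrE// normrX lerXn2r ?nnegrE//.
  exact: beta_max_ge0.
by rewrite eigenvalue_norm_le// k0.
Qed.

(** * Covariances of the centred function under an arbitrary start *)

Variable nu : D -> R.
Hypothesis hnu : is_distribution nu.
Variable f : D -> R.

Local Notation g := (fun x => f x - Smean pi f).

Lemma norm2_center_le : norm2 pi g <= norm2 pi f.
Proof.
rewrite /norm2 ler_wsqrtr//.
suff -> : ip g g = ip f f - Smean pi f ^+ 2 by rewrite lerBlDr lerDl sqr_ge0.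
set S := Smean pi f.
transitivity (\sum_x (f x * f x * pi x - 2 * S * (f x * pi x) + S ^+ 2 * pi x)).
  by apply: eq_bigr => x _; ring.
rewrite big_split sumrB -!mulr_sumr /= -/(ip f f) -/(Smean pi f) -/S.
by case: hpi => _ ->; ring.
Qed.

Lemma inner_center k : (0 < k < #|D|)%N -> ip g (u k) = ip f (u k).
Proof.
move=> /andP[k0 kD].
have uk0 : ip (u k) (u 0) = 0.
  by rewrite (spectral_orthonormal hspec)// ?eqn0Ngt ?k0// (ltn_trans k0 kD).
rewrite inner_u0 in uk0.
set S := Smean pi f.
transitivity (\sum_x (f x * u k x * pi x - S * (u k x * pi x))).
  by apply: eq_bigr => x _; ring.
by rewrite sumrB -mulr_sumr -/(Smean pi (u k)) uk0 mulr0 subr0.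
Qed.

Lemma inner_center_u0 : ip g (u 0) = 0.
Proof.
rewrite inner_u0 {1}/Smean; under eq_bigr do rewrite mulrBl.
by rewrite sumrB -mulr_sumr; case: hpi => _ ->; rewrite mulr1 subrr.
Qed.

(** This is the covariance at lag [m] in the stationary chain; centring removes the index 0. *)
Lemma inner_center_iter m :
  ip g (iter m (Pop p) g) =
  \sum_(1 <= k < #|D|) ip f (u k) ^+ 2 * b k ^+ m.
Proof.
rewrite parseval big_ltn ?(ltnW hD)// inner_center_u0 mul0r add0r.
apply: eq_big_nat => k /andP[k0 kD].
by rewrite inner_iter_Pop// inner_center ?k0//; ring.
Qed.

(** The deviation is an inner product to which Cauchy-Schwarz applies: contracting [dl] gives
    [beta ^+ i], and contracting the second factor of [h] gives [beta ^+ m]. *)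
Lemma covariance_approx i m :
  `|\sum_x nu x * iter i (Pop p) (fun y => g y * iter m (Pop p) g y) x
    - \sum_(1 <= k < #|D|) ip f (u k) ^+ 2 * b k ^+ m| <=
  bias_const pi nu f * beta ^+ (i + m).
Proof.
have pi_gt0 := spectral_pi_gt0.
set h := fun y => g y * iter m (Pop p) g y.
set dl := fun x => nu x / pi x - 1.
(* Both [nu] and [pi] have mass 1, so the density of their difference is orthogonal to the
   constants. *)
have dl0 : ip dl (u 0) = 0.
  rewrite inner_u0 /Smean /dl.
  under eq_bigr => x _ do rewrite mulrBl mul1r divfK ?gt_eqF//.
  by rewrite sumrB; case: hpi => _ ->; case: hnu => _ ->; rewrite subrr.
rewrite -inner_center_iter.
have -> : \sum_x nu x * iter i (Pop p) h x - ip g (iter m (Pop p) g) =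
    ip (iter i (Pop p) dl) h.
  (* Stationarity: since [b 0 = 1], the mean of [h] under [pi] is also that of [iter i (Pop p) h],
     so the two terms can be subtracted pointwise. *)
  have -> : ip g (iter m (Pop p) g) = ip (iter i (Pop p) h) (u 0).
    rewrite inner_iter_Pop ?(ltnW hD)// (spectral_val0 hspec) expr1n mul1r.
    by rewrite inner_u0.
  rewrite (iter_Pop_self_adjoint i dl) /inner -sumrB; apply: eq_bigr => x _.
  rewrite (spectral_vec0 hspec) /dl; field; exact: lt0r_neq0.
apply: le_trans (inner_cauchy_schwarz pi_ge0 _ _) _.
apply: le_trans (ler_pM _ _ (iter_Pop_contraction i dl0)
  (norm2_mul_le pi_ge0 _ _ pi_gt0)) _; rewrite ?sqrtr_ge0//.
have gm := iter_Pop_contraction m inner_center_u0.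
have gf := norm2_center_le.
have bm := exprn_ge0 m beta_max_ge0; have bi := exprn_ge0 i beta_max_ge0.
set s := Num.sqrt _.
have s0 : 0 <= s by exact: sqrtr_ge0.
have d0 : 0 <= norm2 pi dl by exact: sqrtr_ge0.
have g0 : 0 <= norm2 pi g by exact: sqrtr_ge0.
have f0 : 0 <= norm2 pi f by exact: sqrtr_ge0.
have -> : bias_const pi nu f * beta ^+ (i + m) =
    beta ^+ i * norm2 pi dl * (s * norm2 pi f * (beta ^+ m * norm2 pi f)).
  by rewrite /bias_const -/s -/dl exprD; ring.
rewrite ler_wpM2l ?mulr_ge0//.
rewrite ler_pM ?mulr_ge0 ?sqrtr_ge0 ?ler_wpM2l//.
by apply: le_trans gm _; rewrite ler_wpM2l.
Qed.

End Spectral.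

(** * The mean square error: bound and limit *)

Section Error.
Variables (R : realType) (D : finType) (d : measure_display).
Variables (T : measurableType d) (Pr : probability T R).
Variables (p : D -> D -> R) (nu : D -> R) (X : nat -> T -> D).
Hypothesis hX : markov_chain Pr p nu X.
Variables (pi f : D -> R).

Local Notation g := (fun x => f x - Smean pi f).
Local Notation cov n0 i j :=
  (Er Pr (fun w => g (X (i + n0).+1 w) * g (X (j + n0).+1 w))).

(** All states involved are read off one prefix, so the expectation is a finite sum and expanding
    the square only exchanges finite sums. *)
Lemma err_sqr n n0 : (0 < n)%N ->
  n%:R ^+ 2 * err Pr pi X f n n0 ^+ 2 = \sum_(i < n) \sum_(j < n) cov n0 i j.
Proof.
move=> n0_gt0; have nn0 : n%:R != 0 :> R by rewrite pnatr_eq0 -lt0n.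
rewrite /err sqr_sqrtr; last first.
  by apply/fine_ge0/expectation_ge0 => w; exact: sqr_ge0.
pose N := (n + n0)%N.
have mN := @measurable_prefix _ _ _ _ _ _ _ _ hX N.
have iN (i : 'I_n) : (i + n0 <= N)%N by rewrite leq_add2r ltnW.
pose G (i : 'I_n) (t : {ffun 'I_N.+1 -> D}) : R := g (t (inord (i + n0))).
have -> : (fun w => `|Savg X f n n0 w - Smean pi f| ^+ 2) =
    (fun w => (n%:R^-1 * \sum_(i < n) G i (prefix X N w)) ^+ 2).
  apply/funext => w; rewrite real_normK ?num_real//; congr (_ ^+ 2).
  have -> : Smean pi f = n%:R^-1 * \sum_(i < n) Smean pi f.
    by rewrite sumr_const card_ord -[Smean pi f *+ n]mulr_natl mulKf.
  rewrite /Savg -mulrBr; congr (_ * _).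
  (* [Savg] counts times from 1 and [cov] counts from 0, whence the successors in [cov]. *)
  rewrite big_add1 /= big_mkord -sumrB; apply: eq_bigr => i _.
  by rewrite /G -prefixE.
rewrite -/(Er Pr _).
rewrite (Er_finite Pr (fun t => (n%:R^-1 * \sum_(i < n) G i t) ^+ 2) mN).
transitivity (\sum_(i < n) \sum_(j < n) \sum_t G i t * G j t *
    fine (Pr (prefix X N @^-1` [set t]))).
  rewrite mulr_sumr; under [RHS]eq_bigr do rewrite exchange_big /=.
  rewrite [RHS]exchange_big /=; apply: eq_bigr => t _.
  under [RHS]eq_bigr do rewrite -mulr_suml -mulr_sumr.
  rewrite -mulr_suml -mulr_suml mulrA; congr (_ * _).
  by field.
apply: eq_bigr => i _; apply: eq_bigr => j _.
rewrite -(Er_finite Pr (fun t => G i t * G j t) mN).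
by congr Er; apply/funext => w; rewrite /G -!prefixE.
Qed.

Hypothesis hD : (2 <= #|D|)%N.
Hypothesis hpi : is_distribution pi.
Hypothesis hrev : reversible p pi.
Hypothesis hnu : is_distribution nu.
Variables (b : nat -> R) (u : nat -> D -> R).
Hypothesis hspec : spectral_data p pi b u.
Hypothesis hbeta : beta_max D b < 1.

Local Notation beta := (beta_max D b).

(** Starting from the smaller index, the exponents of [beta], [n0 + minn i j] and the lag, add up to
    [n0 + maxn i j]. *)
Lemma cov_approx n0 i j :
  `|cov n0 i j - \sum_(1 <= k < #|D|)
      inner pi f (u k) ^+ 2 * b k ^+ (maxn i j - minn i j)| <=
  bias_const pi nu f * beta ^+ (n0 + maxn i j).
Proof.
wlog ij : i j / (i <= j)%N.
  have /orP[ij|ji] := leq_total i j; first by apply.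
  move/(_ j i ji); rewrite maxnC minnC.
  by under eq_fun do rewrite mulrC.
rewrite (maxn_idPr ij) (minn_idPl ij).
have -> : (j + n0 = i + n0 + (j - i))%N by rewrite addnAC subnKC.
rewrite (Er_two_times hX (i + n0) (j - i) g g).
rewrite (Er_one_time hX (i + n0) (fun x => g x * iter (j - i) (Pop p) g x)).
have := covariance_approx hD hpi hrev hspec hnu f (i + n0) (j - i).
by rewrite (_ : i + n0 + (j - i) = n0 + j)%N// addnAC subnKC// addnC.
Qed.

(** Common source of the bound and of the limit: summed over all pairs, the effect of the start
    stays bounded in [n]. *)
Lemma err_approx n n0 : (0 < n)%N ->
  `|n%:R ^+ 2 * err Pr pi X f n n0 ^+ 2 -
    \sum_(1 <= k < #|D|) inner pi f (u k) ^+ 2 * covsum n (b k)| <=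
  2 * beta ^+ n0 * bias_const pi nu f / (1 - beta) ^+ 2.
Proof.
move=> n_gt0; rewrite err_sqr//.
have b0 := @beta_max_ge0 R D b.
have K0 : 0 <= bias_const pi nu f.
  by rewrite /bias_const !mulr_ge0 ?sqrtr_ge0 ?exprn_ge0 ?sqrtr_ge0.
have -> : \sum_(1 <= k < #|D|) inner pi f (u k) ^+ 2 * covsum n (b k) =
    \sum_(i < n) \sum_(j < n) \sum_(1 <= k < #|D|)
      inner pi f (u k) ^+ 2 * b k ^+ (maxn i j - minn i j).
  under [RHS]eq_bigr do rewrite exchange_big /=.
  rewrite [RHS]exchange_big /=; apply: eq_bigr => k _.
  rewrite /covsum mulr_sumr; apply: eq_bigr => i _.
  by rewrite mulr_sumr.
rewrite -sumrB; under eq_bigr do rewrite -sumrB.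
apply: le_trans (ler_norm_sum _ _ _) _.
apply: le_trans (_ : \sum_(i < n) \sum_(j < n)
    bias_const pi nu f * beta ^+ n0 * beta ^+ maxn i j <= _).
  apply: ler_sum => i _; apply: le_trans (ler_norm_sum _ _ _) _.
  by apply: ler_sum => j _; rewrite -mulrA -exprD cov_approx.
under eq_bigr do rewrite -mulr_sumr.
rewrite -mulr_sumr.
have -> : 2 * beta ^+ n0 * bias_const pi nu f / (1 - beta) ^+ 2 =
    bias_const pi nu f * beta ^+ n0 * (2 / (1 - beta) ^+ 2) by ring.
by rewrite ler_wpM2l ?sum_expr_maxn_le// mulr_ge0// exprn_ge0.
Qed.

Lemma err_sqr_le n n0 : (0 < n)%N ->
  err Pr pi X f n n0 ^+ 2 <=
    2 / (n%:R * (1 - b 1)) * norm2 pi f ^+ 2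
    + 2 * beta ^+ n0 * bias_const pi nu f / (n%:R ^+ 2 * (1 - beta) ^+ 2).
Proof.
move=> n_gt0; have n0R : 0 < n%:R :> R by rewrite ltr0n.
have nn : n%:R != 0 :> R by rewrite gt_eqF.
have b1 : b 1 <= beta by rewrite le_max lexx.
have b1' : 0 < 1 - b 1 by rewrite subr_gt0 (le_lt_trans b1).
have bb : 0 < 1 - beta by rewrite subr_gt0.
rewrite -(ler_pM2l (exprn_gt0 2 n0R)).
have /ler_normlP[_ H] := err_approx n0 n_gt0.
rewrite lerBlDl in H; apply: le_trans H _.
rewrite mulrDr lerD//; last first.
  by rewrite le_eqVlt; apply/orP; left; apply/eqP; field; rewrite nn gt_eqF.
have -> : n%:R ^+ 2 * (2 / (n%:R * (1 - b 1)) * norm2 pi f ^+ 2) =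
    norm2 pi f ^+ 2 * (2 * n%:R / (1 - b 1)).
  by field; rewrite nn gt_eqF.
(* For [k >= 1] one has [b k <= b 1], so every denominator can be replaced by the smallest one,
   [1 - b 1]. *)
apply: le_trans (_ : \sum_(1 <= k < #|D|)
    inner pi f (u k) ^+ 2 * (2 * n%:R / (1 - b 1)) <= _).
  apply: ler_sum_nat => k /andP[k1 kD].
  have bk := eigenvalue_norm_le hspec (introT andP (conj k1 kD)).
  rewrite ler_wpM2l ?sqr_ge0//.
  apply: le_trans (covsum_le n (le_lt_trans bk hbeta)) _.
  rewrite ler_wpM2l ?mulr_ge0// lef_pV2 ?posrE//.
    by rewrite lerB// (spectral_sorted hspec).
  rewrite subr_gt0; apply: le_lt_trans hbeta; apply: le_trans bk.
  exact: ler_norm.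
rewrite -mulr_suml ler_wpM2r//; first by rewrite divr_ge0 ?mulr_ge0// ltW.
have pi_ge0 : forall x, 0 <= pi x by case: hpi.
(* Parseval's identity, with the nonnegative term of [u 0] dropped. *)
rewrite norm2_sqr// (parseval hspec) [leRHS]big_ltn ?(ltnW hD)//.
under [X in _ <= _ + X]eq_bigr do rewrite -expr2.
by rewrite -expr2 lerDr sqr_ge0.
Qed.

Lemma err_sqr_cvg n0 :
  (fun n : nat => n%:R * err Pr pi X f n n0 ^+ 2) @ \oo -->
    \sum_(1 <= k < #|D|) inner pi f (u k) ^+ 2 * ((1 + b k) / (1 - b k)).
Proof.
pose e k := inner pi f (u k) ^+ 2 * (`|2 * b k / (1 - b k)| * (2 / `|1 - b k|)).
(* The constant adds the effect of the start to the errors of the [covsum] terms; neither depends on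
   [n]. *)
apply: (@cvg_of_rate _ _ _ (2 * beta ^+ n0 * bias_const pi nu f / (1 - beta) ^+ 2
  + \sum_(1 <= k < #|D|) e k)) => n n_gt0.
set L := \sum_(1 <= k < #|D|) _.
have -> : n%:R * (n%:R * err Pr pi X f n n0 ^+ 2 - L) =
    (n%:R ^+ 2 * err Pr pi X f n n0 ^+ 2 -
      \sum_(1 <= k < #|D|) inner pi f (u k) ^+ 2 * covsum n (b k)) +
    (\sum_(1 <= k < #|D|) inner pi f (u k) ^+ 2 * covsum n (b k) - n%:R * L).
  by ring.
apply: le_trans (ler_normD _ _) _; rewrite lerD ?err_approx//.
rewrite mulr_sumr -sumrB; apply: le_trans (ler_norm_sum _ _ _) _.
apply: ler_sum_nat => k /andP[k1 kD].
have bk : `|b k| < 1.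
  by apply: le_lt_trans hbeta; rewrite (eigenvalue_norm_le hspec)// k1.
rewrite mulrCA -mulrBr normrM ger0_norm ?sqr_ge0// ler_wpM2l ?sqr_ge0//.
exact: covsum_approx.
Qed.

End Error.

Unset Implicit Arguments.

Theorem theorem2p20 (R : realType) (D : finType) (hD : (2 <= #|D|)%N)
    (p : D -> D -> R) (pi nu : D -> R)
    (hp : is_transition_matrix p)
    (hirr : irreducible p) (haper : aperiodic p)
    (hpi : is_distribution pi) (hrev : reversible p pi)
    (hnu : is_distribution nu)
    (b : nat -> R) (u : nat -> D -> R) (hspec : spectral_data p pi b u)
    (hbeta : beta_max D b < 1)
    (d : measure_display) (T : measurableType d) (Pr : probability T R)
    (X : nat -> T -> D) (hX : markov_chain Pr p nu X)
    (f : D -> R) :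
  (forall n n0 : nat, (0 < n)%N ->
     err Pr pi X f n n0 ^+ 2 <=
       2 / (n%:R * (1 - b 1%N)) * norm2 pi f ^+ 2
       + 2 * beta_max D b ^+ n0 * Num.sqrt (norm_inf (fun x => 1 / pi x))
           * norm2 pi (fun x => nu x / pi x - 1)
         / (n%:R ^+ 2 * (1 - beta_max D b) ^+ 2) * norm2 pi f ^+ 2)
  /\ (forall n0 : nat,
        (fun n : nat => n%:R * err Pr pi X f n n0 ^+ 2) @ \oo -->
          \sum_(1 <= k < #|D|)
             inner pi f (u k) ^+ 2 * ((1 + b k) / (1 - b k)))
  /\ (forall (d' : measure_display) (T' : measurableType d')
        (Pr' : probability T' R) (Y : nat -> T' -> D),
        markov_chain Pr' p pi Y ->
        (fun n : nat => n%:R * err Pr' pi Y f n 0 ^+ 2) @ \oo -->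
          \sum_(1 <= k < #|D|)
             inner pi f (u k) ^+ 2 * ((1 + b k) / (1 - b k))).

Proof.
split; last split.
- move=> n n0 n_gt0.
  have := err_sqr_le hX f hD hpi hrev hnu hspec hbeta n0 n_gt0.
  move=> /le_trans; apply; rewrite le_eqVlt; apply/orP; left; apply/eqP.
  by rewrite /bias_const; ring.
- by move=> n0; exact: (err_sqr_cvg hX).
(* The stationary start is the instance [nu = pi], [n0 = 0]; the limit does not depend on the
   initial law. *)
- by move=> d' T' Pr' Y hY; exact: (err_sqr_cvg hY).
Qed.
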